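(* The length generating function of weakly directed walks (horizontal model) is $$ \overline W(t)=1+\bigl(2T_i(t)-2t\bigr)+2\bigl(2Q_i(t)-t\bigr)\,W(t)\,\bigl(2P_i(t)-t\bigr), $$ where the series $T_i(t)$, $P_i(t)$ and $Q_i(t)$ count (by length) respectively general, positive, and copositive irreducible NES-walks, and are given by $$ T_i(t)=T(t)-1-2Q_i(t)\bigl(1+tB(t)\bigr)P_i(t),\qquad P_i(t)=\frac{P(t)-1}{1+tB(t)},\qquad Q_i(t)=\frac{Q(t)-1}{1+tB(t)}. $$ Here $W$ is the generating function of weakly directed bridges, $B$ that of NES-pseudo-bridges, and $T,P,Q$ those of general, positive and copositive NES-walks (explicit expressions are recalled in the context).
   Context: The square lattice steps are N$=(0,1)$, E$=(1,0)$, S$=(0,-1)$, W$=(-1,0)$. All walks $v_0,\dots,v_n$ on $\mathbb{Z}^2$ are self-avoiding and counted up to translation by their length (number of steps); the empty walk is allowed. A NES-walk is a self-avoiding walk with all steps in $\{$N, E, S$\}$. The height $h(v)$ of a vertex is its ordinate. A walk is weakly directed if whenever $i<j$ and $h(v_i)=h(v_j)$, the portion $v_i,\dots,v_j$ avoids at least one of the steps N, E, S, W. A walk is a bridge if all vertices $v\ne v_n$ satisfy $h(v_0)\le h(v)<h(v_n)$, and a pseudo-bridge if all vertices satisfy $h(v_0)\le h(v)\le h(v_n)$ (its height is $h(v_n)-h(v_0)$). A walk is positive if all its vertices $v$ satisfy $h(v)\ge h(v_0)$, and copositive if all vertices $v\neq v_n$ satisfy $h(v)<h(v_n)$. Irreducibility: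 let $r$ be the reflection through the $x$-axis. A nonempty walk is N-reducible if it is of the form $qp$ (concatenation) with $q$ a nonempty copositive walk and $p$ a nonempty positive walk; it is S-reducible if $r(w)$ is N-reducible; it is irreducible if it is nonempty and neither N-reducible nor S-reducible. Explicit series: $B=\sum_{k\ge0}t^k/G_k(t)$ with $G_{-1}=1$, $G_0=1-t$, $G_{k+1}=(1-t+t^2+t^3)G_k-t^2G_{k-1}$ for $k\ge 0$ ($t^k/G_k$ counts NES-pseudo-bridges of height $k$); $W=\dfrac{1}{1+t-\frac{2tB}{1+tB}}$ (weakly directed bridges); $T=\dfrac{1+t}{1-2t-t^2}$ (all NES-walks); $P=\dfrac{1}{2t^2}\Bigl(\sqrt{\tfrac{1-t^4}{1-2t-t^2}}-1-t\Bigr)$ (positive NES-walks); $Q=1+tP$ (copositive NES-walks). *)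

(* Defs.v *)
From HB Require Import structures.
From mathcomp Require Import all_boot all_order all_algebra.
From mathcomp Require Import boolp.

Set Implicit Arguments.
Unset Strict Implicit.
Unset Printing Implicit Defensive.

Import GRing.Theory.
Local Open Scope ring_scope.

(** * Formal power series in one variable *)

(* A record rather than an alias of [nat -> R], so that [*] is the Cauchy
   product and never a pointwise product of functions. *)
Record fps (R : Type) := Fps { coefs : nat -> R }.
Notation "{ 'fps' R }" := (fps R) (at level 0, format "{ 'fps'  R }").

HB.instance Definition _ (R : Type) := [isNew for @coefs R].
HB.instance Definition _ (R : choiceType) := [Choice of fps R by <:].

Lemma fpsP (R : Type) (f g : {fps R}) : (forall n, coefs f n = coefs g n) -> f = g.
Proof. by case: f g => [f] [g] /= fg; congr Fps; apply: funext. Qed.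

Section ZmodFps.
Variable R : zmodType.
Implicit Types f g h : {fps R}.

Definition fps_zero : {fps R} := Fps (fun _ => 0).
Definition fps_opp f : {fps R} := Fps (fun n => - coefs f n).
Definition fps_add f g : {fps R} := Fps (fun n => coefs f n + coefs g n).

Fact fps_addA : associative fps_add.
Proof. by move=> f g h; apply: fpsP => n /=; rewrite addrA. Qed.
Fact fps_addC : commutative fps_add.
Proof. by move=> f g; apply: fpsP => n /=; rewrite addrC. Qed.
Fact fps_add0 : left_id fps_zero fps_add.
Proof. by move=> f; apply: fpsP => n /=; rewrite add0r. Qed.
Fact fps_addN : left_inverse fps_zero fps_opp fps_add.
Proof. by move=> f; apply: fpsP => n /=; rewrite addNr. Qed.

HB.instance Definition _ :=
  GRing.isZmodule.Build (fps R) fps_addA fps_addC fps_add0 fps_addN.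

End ZmodFps.

Section RingFps.
Variable R : comNzRingType.
Implicit Types f g h : {fps R}.

Definition fps_one : {fps R} := Fps (fun n => (n == 0)%:R).
Definition fps_mul f g : {fps R} :=
  Fps (fun n => \sum_(i < n.+1) coefs f i * coefs g (n - i)%N).

(* The Cauchy product seen on truncations, where it is the product of
   polynomials. *)
Fact fps_mul_trunc f g m n : (n < m)%N ->
  coefs (fps_mul f g) n
    = ((\poly_(i < m) coefs f i) * (\poly_(i < m) coefs g i))`_n.
Proof.
move=> ltnm; rewrite coefM; apply: eq_bigr => i _.
by rewrite !coef_poly !ifT // (leq_ltn_trans _ ltnm) ?leq_subr // -ltnS.
Qed.

Fact fps_mulA : associative fps_mul.
Proof.
move=> f g h; apply: fpsP => n.
rewrite !(@fps_mul_trunc _ _ n.+1) //.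
set F := \poly_(i < n.+1) coefs f i; set G := \poly_(i < n.+1) coefs g i.
set H := \poly_(i < n.+1) coefs h i.
transitivity (F * (G * H))`_n; last rewrite mulrA.
  rewrite !coefM; apply: eq_bigr => i _; congr (_ * _).
  by rewrite coef_poly ltnS leq_subr (@fps_mul_trunc _ _ n.+1) // ltnS leq_subr.
rewrite !coefM; apply: eq_bigr => i _; congr (_ * _).
by rewrite coef_poly ltn_ord (@fps_mul_trunc _ _ n.+1).
Qed.

Fact fps_mulC : commutative fps_mul.
Proof.
by move=> f g; apply: fpsP => n; rewrite !(@fps_mul_trunc _ _ n.+1) // mulrC.
Qed.

Fact fps_mul1 : left_id fps_one fps_mul.
Proof.
move=> f; apply: fpsP => n /=; rewrite big_ord_recl /= mul1r subn0.
by rewrite big1 ?addr0 // => i _; rewrite mul0r.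
Qed.

Fact fps_mulDl : left_distributive fps_mul (@fps_add R).
Proof.
move=> f g h; apply: fpsP => n /=; rewrite -big_split /=.
by apply: eq_bigr => i _; rewrite mulrDl.
Qed.

Fact fps_oner_neq0 : fps_one != fps_zero R.
Proof.
apply/eqP => /(congr1 (fun f => coefs f 0)) /= /eqP.
by rewrite oner_eq0.
Qed.

HB.instance Definition _ := GRing.Zmodule_isComNzRing.Build (fps R)
  fps_mulA fps_mulC fps_mul1 fps_mulDl fps_oner_neq0.

End RingFps.

Section UnitFps.
Variable R : comUnitRingType.
Implicit Types f g : {fps R}.

Definition fps_unit : pred {fps R} := fun f => coefs f 0 \is a GRing.unit.

(* The list of the first [n.+1] coefficients of the inverse of [f], obtained
   from f_0 g_0 = 1 and f_0 g_n = - (f_1 g_(n-1) + ... + f_n g_0). *)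
Fixpoint fps_inv_seq f n : seq R :=
  if n is m.+1 then
    let s := fps_inv_seq f m in
    rcons s (- (coefs f 0)^-1 * \sum_(i < m.+1) coefs f i.+1 * s`_(m - i))
  else [:: (coefs f 0)^-1].

Definition fps_inv f : {fps R} :=
  if fps_unit f then Fps (fun n => (fps_inv_seq f n)`_n) else f.

Fact size_fps_inv_seq f n : size (fps_inv_seq f n) = n.+1.
Proof. by elim: n => //= n IHn; rewrite size_rcons IHn. Qed.

Fact nth_fps_inv_seq f m n : (m <= n)%N ->
  (fps_inv_seq f n)`_m = (fps_inv_seq f m)`_m.
Proof.
elim: n => [|n IHn]; first by rewrite leqn0 => /eqP->.
rewrite leq_eqVlt => /predU1P[-> //|ltmn].
by rewrite /= nth_rcons size_fps_inv_seq ltmn IHn.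
Qed.

Fact fps_mulVr : {in fps_unit, left_inverse 1 fps_inv *%R}.
Proof.
move=> f uf; have uf0 : coefs f 0 \is a GRing.unit by [].
rewrite mulrC /fps_inv ifT //.
apply: fpsP => -[|n]; rewrite {1}/GRing.mul /=.
  by rewrite big_ord_recl big_ord0 addr0 /= divrr.
rewrite big_ord_recl subn0 /= nth_rcons size_fps_inv_seq ltnn eqxx.
rewrite mulrA mulrN divrr // mulN1r addrC; apply/eqP; rewrite subr_eq0; apply/eqP.
apply: eq_bigr => i _; congr (_ * _).
by rewrite subSS [RHS]nth_fps_inv_seq ?leq_subr.
Qed.

Fact fps_unitP f g : g * f = 1 -> fps_unit f.
Proof.
move=> /(congr1 (fun h => coefs h 0)); rewrite /GRing.mul /=.
rewrite big_ord_recl big_ord0 addr0 subnn => gf1.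
by apply/unitrPr; exists (coefs g 0); rewrite mulrC.
Qed.

Fact fps_inv_out : {in [predC fps_unit], fps_inv =1 id}.
Proof. by move=> f /negPf nuf; rewrite /fps_inv ifF. Qed.

HB.instance Definition _ := GRing.ComNzRing_hasMulInverse.Build (fps R)
  fps_mulVr fps_unitP fps_inv_out.

End UnitFps.

(* The variable t of the series. *)
Definition fps_t {R : comNzRingType} : {fps R} := Fps (fun n => (n == 1)%:R).

(** * Lattice walks *)

Inductive step := North | East | South | West.

Definition ord_of_step (s : step) : 'I_4 :=
  match s with
  | North => inord 0 | East => inord 1 | South => inord 2 | West => inord 3
  end.
Definition step_of_ord (i : 'I_4) : step := nth North [:: North; East; South; West] i.
Fact ord_of_stepK : cancel ord_of_step step_of_ord.
Proof. by case; rewrite /step_of_ord /= inordK. Qed.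
HB.instance Definition _ := Finite.copy step (can_type ord_of_stepK).

Definition point : Type := (int * int)%type.

Definition move (v : point) (s : step) : point :=
  match s with
  | North => (v.1, v.2 + 1)
  | East => (v.1 + 1, v.2)
  | South => (v.1, v.2 - 1)
  | West => (v.1 - 1, v.2)
  end.

(* A walk up to translation is the word of its steps; it is represented by its
   translate starting at the origin. *)
Definition walk : Type := seq step.

Definition vertices (w : walk) : seq point := (0, 0) :: scanl move (0, 0) w.
Definition vertex (w : walk) (i : nat) : point := nth (0, 0) (vertices w) i.
Definition first_vertex (w : walk) : point := vertex w 0.
Definition last_vertex (w : walk) : point := vertex w (size w).

Definition height (v : point) : int := v.2.

Definition self_avoiding (w : walk) : bool := uniq (vertices w).

Definition NES (w : walk) : bool :=
  all (fun s => s \in [:: North; East; South]) w.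

(* The steps of the portion v_i, ..., v_j are [take (j - i) (drop i w)]. *)
Definition weakly_directed (w : walk) : bool :=
  [forall i : 'I_(size w).+1, forall j : 'I_(size w).+1,
    (i < j)%N && (height (vertex w i) == height (vertex w j)) ==>
    [exists s : step, s \notin take (j - i) (drop i w)]].

Definition bridge (w : walk) : bool :=
  all (fun v => (v != last_vertex w) ==>
         (height (first_vertex w) <= height v < height (last_vertex w)))
      (vertices w).

Definition pseudo_bridge (w : walk) : bool :=
  all (fun v => height (first_vertex w) <= height v <= height (last_vertex w))
      (vertices w).

Definition positive (w : walk) : bool :=
  all (fun v => height (first_vertex w) <= height v) (vertices w).

Definition copositive (w : walk) : bool :=
  all (fun v => (v != last_vertex w) ==> (height v < height (last_vertex w)))
      (vertices w).

Definition reflect_step (s : step) : step :=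
  match s with
  | North => South | South => North | East => East | West => West
  end.
Definition reflection (w : walk) : walk := map reflect_step w.

(* A factorization w = q ++ p into nonempty words is given by its cut 0 < k < size w;
   both factors of a self-avoiding walk are self-avoiding. *)
Definition N_reducible (w : walk) : bool :=
  [exists k : 'I_(size w),
    [&& (0 < k)%N, copositive (take k w) & positive (drop k w)]].

Definition S_reducible (w : walk) : bool := N_reducible (reflection w).

Definition irreducible (w : walk) : bool :=
  [&& w != [::], ~~ N_reducible w & ~~ S_reducible w].

(* Length generating function of the self-avoiding walks satisfying [C]. *)
Definition walk_gf (C : pred walk) : {fps rat} :=
  Fps (fun n => #|[set w : n.-tuple step | self_avoiding w && C w]|%:R).

(* Main.v *)
Require Import Defs.
From mathcomp Require Import all_boot all_order all_algebra.
From mathcomp Require Import zify ring.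

Import GRing.Theory.
Local Open Scope ring_scope.

(** Let C be a class of self-avoiding walks containing the empty walk,
    invariant under the reflection through the x-axis, and such that a product
    q p with q copositive and p positive is in C iff q and p are ([cut_stable]).
    NES-walks form such a class, and so do weakly directed walks, because two
    vertices of q p at the same height lie either both on q, strictly before
    its end, or both on p.  In any such class:
    - a nonempty positive walk is uniquely a possibly empty bridge followed by an
      irreducible positive walk (cut at the last possible place);
    - a nonempty copositive walk is uniquely an irreducible copositive walk
      followed by a possibly empty bridge (cut at the first possible place);
    - an N-reducible walk is uniquely an irreducible copositive walk followed by
      a nonempty positive walk (cut at the first possible place).
    An N-reducible walk goes strictly up and an S-reducible one strictly down, and
    the reflection exchanges the two kinds.  Writing I, I_q, I_p and V for the
    series of irreducible walks, irreducible copositive walks, irreducible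
    positive walks and bridges of C, the series of C is therefore
    1 + I + 2 I_q V I_p ([walk_gf_irreducible]).

    For NES-walks V = 1 + t B, since a nonempty NES-bridge is a pseudo-bridge
    followed by a step N ([walk_gf_NES_bridge]); this gives the formulas for
    T_i, P_i and Q_i.  For weakly directed walks V = W, and the point is that an
    irreducible weakly directed walk avoids E or avoids W
    ([irreducible_weakly_directed]): otherwise it contains a step E or W and,
    after a vertical run, the opposite horizontal step, and it can be cut
    inside this run ([turn_N_reducible]).  Hence I, I_q and I_p are twice
    the corresponding NES-series, minus the walks counted twice, namely N and S
    (only N in the copositive and positive cases). *)

(** * Positions and heights along a walk *)

(** The displacement of a walk, from its first to its last vertex. *)
Definition displacement (w : walk) : point := foldl move (0, 0) w.

(** The height reached by a walk; the height of vertex number [i] of [w] is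
    [rise (take i w)]. *)
Definition rise (w : walk) : int := (displacement w).2.

Lemma foldl_move (v : point) (w : walk) :
  foldl move v w = (v.1 + (displacement w).1, v.2 + (displacement w).2).
Proof.
rewrite /displacement; elim: w v => [|s w IHw] v /=.
  by case: v => a b; rewrite /= !addr0.
rewrite IHw [in RHS]IHw; case: s => /=; congr (_, _); lia.
Qed.

Lemma displacement_cat (u v : walk) :
  displacement (u ++ v)
    = ((displacement u).1 + (displacement v).1,
       (displacement u).2 + (displacement v).2).
Proof. by rewrite /displacement foldl_cat foldl_move. Qed.

Lemma displacement1 (s : step) : displacement [:: s] = move (0, 0) s.
Proof. by []. Qed.

Lemma rise_cat (u v : walk) : rise (u ++ v) = rise u + rise v.
Proof. by rewrite /rise displacement_cat. Qed.

Lemma rise_cons (s : step) (w : walk) : rise (s :: w) = rise [:: s] + rise w.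
Proof. by rewrite -cat1s rise_cat. Qed.

Lemma rise_nil : rise [::] = 0. Proof. by []. Qed.

Lemma rise_nseq (m : nat) : rise (nseq m North) = m%:Z.
Proof. by elim: m => //= m IHm; rewrite rise_cons IHm /rise /=; lia. Qed.

Lemma rise_take_cat (q p : walk) (i : nat) :
  rise (take i (q ++ p)) =
    if (i <= size q)%N then rise (take i q) else rise q + rise (take (i - size q) p).
Proof.
rewrite take_cat; case: (ltngtP i (size q)) => // [_|->]; first exact: rise_cat.
by rewrite subnn take0 cats0 take_size.
Qed.

Lemma rise_take_step (w : walk) (i : nat) :
  `|rise (take i.+1 w) - rise (take i w)| <= 1.
Proof.
elim: w i => [|s w IHw] [|i] //=; last first.
  by rewrite rise_cons [X in _ - X]rise_cons; have := IHw i; lia.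
by rewrite take0 rise_cons; case: s.
Qed.

Lemma vertexE (w : walk) (i : nat) :
  (i <= size w)%N -> vertex w i = displacement (take i w).
Proof.
rewrite /vertex /vertices /displacement; case: i => [|i] lei; first by rewrite take0.
by rewrite /= nth_scanl.
Qed.

Lemma last_vertexE (w : walk) : last_vertex w = displacement w.
Proof. by rewrite /last_vertex vertexE // take_size. Qed.

Lemma size_vertices (w : walk) : size (vertices w) = (size w).+1.
Proof. by rewrite /= size_scanl. Qed.

Lemma all_vertices (a : pred point) (w : walk) :
  reflect (forall i, (i <= size w)%N -> a (displacement (take i w)))
          (all a (vertices w)).
Proof.
apply: (iffP (all_nthP (0, 0))) => [aw i lei | aw i].
  by rewrite -vertexE //; apply: aw; rewrite size_vertices.
by rewrite size_vertices ltnS => lei; rewrite -[nth _ _ _]/(vertex w i) vertexE // aw.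
Qed.

Lemma self_avoidingP (w : walk) :
  reflect (forall i j, (i < j <= size w)%N ->
             displacement (take i w) <> displacement (take j w))
          (self_avoiding w).
Proof.
apply: (iffP (uniqP (0, 0))) => [inj i j /andP[ltij lej] eqij | neq i j].
  have lei := leq_trans (ltnW ltij) lej.
  have /eqP: i = j.
    apply: inj; rewrite ?inE ?size_vertices ?ltnS //.
    by rewrite -![nth _ _ _]/(vertex w _) !vertexE.
  by rewrite (ltn_eqF ltij).
rewrite !inE size_vertices !ltnS => lei lej.
rewrite -![nth _ _ _]/(vertex w _) !vertexE // => eqij.
by case: (ltngtP i j) => // ltij; [case: (neq i j) | case: (neq j i)]; rewrite ?ltij.
Qed.

Lemma self_avoiding_prefix {q p : walk} : self_avoiding (q ++ p) -> self_avoiding q.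
Proof.
move=> /self_avoidingP sa; apply/self_avoidingP => i j /andP[ltij lej].
have := sa i j; rewrite size_cat !takel_cat //; last by lia.
by apply; lia.
Qed.

Lemma self_avoiding_suffix {q p : walk} : self_avoiding (q ++ p) -> self_avoiding p.
Proof.
move=> /self_avoidingP sa; apply/self_avoidingP => i j /andP[ltij lej] eqij.
apply: (sa (size q + i) (size q + j))%N; first by rewrite size_cat; lia.
by rewrite !takeD !take_size_cat // !drop_size_cat // !displacement_cat eqij.
Qed.

Lemma positiveP (w : walk) : reflect (forall i, 0 <= rise (take i w)) (positive w).
Proof.
apply: (iffP (all_vertices _ _)) => [pos i | pos i _]; last exact: pos.
case: (leqP i (size w)) => [/pos // | /ltnW lei].
by rewrite take_oversize // -[w]take_size; apply: pos.
Qed.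

(** In a self-avoiding walk the last vertex is visited once, so copositivity
    bounds every vertex of smaller index. *)
Lemma copositiveP (w : walk) :
  self_avoiding w ->
  reflect (forall i, (i < size w)%N -> rise (take i w) < rise w) (copositive w).
Proof.
move=> /self_avoidingP sa; apply: (iffP (all_vertices _ _)) => [cop i lti | cop i lei].
  have /implyP := cop i (ltnW lti); rewrite last_vertexE; apply.
  by apply/eqP; rewrite -[in X in _ <> X](take_size w); apply: sa; rewrite lti /=.
apply/implyP; rewrite last_vertexE => neq; apply: cop.
by rewrite ltn_neqAle lei andbT; apply: contraNneq neq => ->; rewrite take_size.
Qed.

Lemma pseudo_bridgeP (w : walk) :
  reflect (forall i, 0 <= rise (take i w) <= rise w) (pseudo_bridge w).
Proof.
apply: (iffP (all_vertices _ _)) => [pos i | pos i _]; last first.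
  by rewrite last_vertexE; apply: pos.
rewrite last_vertexE in pos.
case: (leqP i (size w)) => [/pos // | /ltnW lei].
by rewrite take_oversize // -[in X in _ <= X <= _](take_size w); apply: pos.
Qed.

Lemma copositive_rise_ge0 {w : walk} :
  self_avoiding w -> copositive w -> 0 <= rise w.
Proof.
move=> sa /(copositiveP _ sa) cop; case: (posnP (size w)) => [/size0nil -> // | /cop].
by rewrite take0 rise_nil; lia.
Qed.

Lemma copositive_rise_gt0 {w : walk} :
  self_avoiding w -> copositive w -> w != [::] -> 0 < rise w.
Proof.
by move=> sa /(copositiveP _ sa) cop; rewrite -size_eq0 -lt0n => /cop; rewrite take0.
Qed.

Lemma bridgeE (w : walk) :
  self_avoiding w -> bridge w = positive w && copositive w.
Proof.
move=> sa; apply/idP/andP => [br | [pos cop]].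
  have cop : copositive w.
    by apply: sub_all br => v /implyP br; apply/implyP => /br /andP[].
  split=> //; apply/all_vertices => i lei.
  have := all_vertices _ _ br i lei; rewrite last_vertexE.
  case: eqP => [-> _ | _ /andP[] //]; exact: copositive_rise_ge0.
apply/all_vertices => i lei; apply/implyP => neq.
have := all_vertices _ _ pos i lei; have := all_vertices _ _ cop i lei.
by rewrite neq /= => -> ->.
Qed.

(** * Concatenation over a cut *)

Lemma self_avoiding_cat (q p : walk) :
  self_avoiding q -> self_avoiding p -> copositive q -> positive p ->
  self_avoiding (q ++ p).
Proof.
move=> saq sap /(copositiveP _ saq) cop /positiveP pos.
apply/self_avoidingP => i j /andP[ltij]; rewrite size_cat => lej eqij.
case: (ltnP i (size q)) => [ltiq | leqi].
  case: (ltnP j (size q)) => [ltjq | leqj].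
    move/self_avoidingP: saq => /(_ i j); rewrite ltij (ltnW ltjq) => /(_ isT).
    by move: eqij; rewrite !take_cat ltiq ltjq.
  have /= := congr1 snd eqij; rewrite -!/(rise _) take_cat ltiq take_cat ltnNge leqj /=.
  by rewrite rise_cat; have := cop i ltiq; have := pos (j - size q)%N; lia.
move/self_avoidingP: sap => /(_ (i - size q) (j - size q))%N; case; first by lia.
have leqj : (size q <= j)%N by lia.
move: eqij; rewrite !take_cat !ltnNge leqi leqj /= !displacement_cat.
by case=> /addrI eq1 /addrI eq2; rewrite [LHS]surjective_pairing eq1 eq2 -surjective_pairing.
Qed.

Lemma positive_cat (q p : walk) : positive q -> positive p -> positive (q ++ p).
Proof.
move=> /positiveP pq /positiveP pp; apply/positiveP => i.
rewrite rise_take_cat; case: ifP => // _.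
by have := pq (size q); have := pp (i - size q)%N; rewrite take_size; lia.
Qed.

Lemma positive_prefix (q p : walk) : positive (q ++ p) -> positive q.
Proof.
move=> /positiveP pos; apply/positiveP => i; case: (leqP i (size q)) => [lei | /ltnW lti].
  by have := pos i; rewrite takel_cat.
by have := pos (size q); rewrite take_size_cat // take_oversize.
Qed.

Lemma copositive_cat (q p : walk) :
  self_avoiding (q ++ p) -> copositive q -> copositive p -> copositive (q ++ p).
Proof.
move=> sa cq cp; have saq := self_avoiding_prefix sa; have sap := self_avoiding_suffix sa.
have rp := copositive_rise_ge0 sap cp.
move: cq cp => /(copositiveP _ saq) cq /(copositiveP _ sap) cp.
apply/copositiveP => // i; rewrite size_cat take_cat rise_cat => lti.
case: ltnP => [/cq | leqi]; first by lia.
by rewrite rise_cat; have := cp (i - size q)%N; lia.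
Qed.

Lemma copositive_suffix (q p : walk) :
  self_avoiding (q ++ p) -> copositive (q ++ p) -> copositive p.
Proof.
move=> sa /(copositiveP _ sa) cop.
apply/copositiveP => [|i lti]; first exact: self_avoiding_suffix sa.
have := cop (size q + i)%N; rewrite size_cat ltn_add2l => /(_ lti).
by rewrite takeD take_size_cat // drop_size_cat // !rise_cat; lia.
Qed.

Lemma N_reducibleP (w : walk) :
  reflect (exists q p, [/\ w = q ++ p, q != [::], p != [::], copositive q & positive p])
          (N_reducible w).
Proof.
apply: (iffP existsP) => [[k /and3P[k0 cop pos]] | [q [p [-> q0 p0 cop pos]]]].
  exists (take k w), (drop k w); split=> //; first by rewrite cat_take_drop.
    by rewrite -size_eq0 size_take ltn_ord -lt0n.
  by rewrite -size_eq0 size_drop -lt0n subn_gt0.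
have ltq : (size q < size (q ++ p))%N.
  by rewrite size_cat -[X in (X < _)%N]addn0 ltn_add2l lt0n size_eq0.
exists (Ordinal ltq) => /=; rewrite take_size_cat // drop_size_cat // cop pos.
by rewrite lt0n size_eq0 q0.
Qed.

(** * Symmetries *)

(** Exchange of the steps E and W, the reflection through the y-axis. *)
Definition mirror_step (s : step) : step :=
  match s with
  | North => North | South => South | East => West | West => East
  end.

Lemma reflect_stepK : involutive reflect_step. Proof. by case. Qed.
Lemma mirror_stepK : involutive mirror_step. Proof. by case. Qed.
Lemma reflectionK : involutive reflection.
Proof. exact: mapK reflect_stepK. Qed.

Lemma displacement_reflection (w : walk) :
  displacement (reflection w) = ((displacement w).1, - (displacement w).2).
Proof.
elim: w => [|s w IHw] //=; rewrite -cat1s -[in RHS]cat1s !displacement_cat IHw /=.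
by rewrite !displacement1; case: s => /=; congr (_, _); lia.
Qed.

Lemma displacement_mirror (w : walk) :
  displacement (map mirror_step w) = (- (displacement w).1, (displacement w).2).
Proof.
elim: w => [|s w IHw] //=; rewrite -cat1s -[in RHS]cat1s !displacement_cat IHw /=.
by rewrite !displacement1; case: s => /=; congr (_, _); lia.
Qed.

Lemma rise_reflection (w : walk) : rise (reflection w) = - rise w.
Proof. by rewrite /rise displacement_reflection. Qed.

Lemma rise_mirror (w : walk) : rise (map mirror_step w) = rise w.
Proof. by rewrite /rise displacement_mirror. Qed.

Lemma self_avoiding_reflection (w : walk) : self_avoiding (reflection w) = self_avoiding w.
Proof.
suff sub u : self_avoiding u -> self_avoiding (reflection u).
  by apply/idP/idP => [/sub|/sub //]; rewrite reflectionK.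
move=> /self_avoidingP sa; apply/self_avoidingP => i j; rewrite size_map => ltij.
rewrite /reflection -!map_take -!/(reflection _) !displacement_reflection => eqij.
apply: (sa i j ltij); case: eqij => eq1 /oppr_inj eq2.
by rewrite [LHS]surjective_pairing eq1 eq2 -surjective_pairing.
Qed.

Lemma self_avoiding_mirror (w : walk) :
  self_avoiding (map mirror_step w) = self_avoiding w.
Proof.
suff sub u : self_avoiding u -> self_avoiding (map mirror_step u).
  by apply/idP/idP => [/sub|/sub //]; rewrite (mapK mirror_stepK).
move=> /self_avoidingP sa; apply/self_avoidingP => i j; rewrite size_map => ltij.
rewrite -!map_take !displacement_mirror => eqij.
apply: (sa i j ltij); case: eqij => /oppr_inj eq1 eq2.
by rewrite [LHS]surjective_pairing eq1 eq2 -surjective_pairing.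
Qed.

Lemma positive_mirror (w : walk) : positive (map mirror_step w) = positive w.
Proof.
by apply/positiveP/positiveP => pos i; have := pos i; rewrite -map_take rise_mirror.
Qed.

Lemma copositive_mirror (w : walk) :
  self_avoiding w -> copositive (map mirror_step w) = copositive w.
Proof.
move=> sa; have sam : self_avoiding (map mirror_step w) by rewrite self_avoiding_mirror.
apply/(copositiveP _ sam)/(copositiveP _ sa); rewrite size_map => cop i /cop.
  by rewrite -map_take !rise_mirror.
by rewrite -map_take !rise_mirror.
Qed.

Lemma N_reducible_mirror (w : walk) :
  self_avoiding w -> N_reducible (map mirror_step w) = N_reducible w.
Proof.
suff sub u : self_avoiding u -> N_reducible u -> N_reducible (map mirror_step u).
  move=> sa; apply/idP/idP => [|/sub->//].
  by move=> /sub; rewrite self_avoiding_mirror (mapK mirror_stepK); apply.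
move=> sa /N_reducibleP[q [p [def_u q0 p0 cop pos]]]; apply/N_reducibleP.
exists (map mirror_step q), (map mirror_step p).
rewrite positive_mirror pos copositive_mirror; last first.
  by move: sa; rewrite def_u; apply: self_avoiding_prefix.
by rewrite cop def_u map_cat -!size_eq0 !size_map !size_eq0.
Qed.

Lemma reflection_mirror (w : walk) :
  reflection (map mirror_step w) = map mirror_step (reflection w).
Proof. by rewrite /reflection -!map_comp; apply: eq_map; case. Qed.

Lemma irreducible_mirror (w : walk) :
  self_avoiding w -> irreducible (map mirror_step w) = irreducible w.
Proof.
move=> sa; rewrite /irreducible /S_reducible reflection_mirror.
rewrite !N_reducible_mirror ?self_avoiding_reflection //.
by rewrite -size_eq0 size_map size_eq0.
Qed.

(** * Cutting off an irreducible factor *)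

Lemma N_reducible_rise {w : walk} : self_avoiding w -> N_reducible w -> 0 < rise w.
Proof.
move=> sa /N_reducibleP[q [p [def_w q0 p0 cop /positiveP/(_ (size p))]]].
rewrite take_size {}def_w in sa *; have := copositive_rise_gt0 (self_avoiding_prefix sa) cop q0.
by rewrite rise_cat; lia.
Qed.

Lemma S_reducible_rise {w : walk} : self_avoiding w -> S_reducible w -> rise w < 0.
Proof.
by rewrite -self_avoiding_reflection => /N_reducible_rise/[apply]; rewrite rise_reflection; lia.
Qed.

Lemma positive_irreducible {w : walk} :
  self_avoiding w -> positive w -> irreducible w = (w != [::]) && ~~ N_reducible w.
Proof.
move=> sa /positiveP/(_ (size w)); rewrite take_size /irreducible => rw.
have /negPf-> : ~~ S_reducible w by apply/negP => /(S_reducible_rise sa); lia.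
by rewrite andbT.
Qed.

Lemma copositive_irreducible {w : walk} :
  self_avoiding w -> copositive w -> irreducible w = (w != [::]) && ~~ N_reducible w.
Proof.
move=> sa /(copositive_rise_ge0 sa) rw; rewrite /irreducible.
have /negPf-> : ~~ S_reducible w by apply/negP => /(S_reducible_rise sa); lia.
by rewrite andbT.
Qed.

(** Iterating the factorization of the second factor reaches the last cut. *)
Lemma positive_factor (w : walk) :
  self_avoiding w -> w != [::] -> positive w ->
  exists q p, [/\ w = q ++ p, bridge q, irreducible p & positive p].
Proof.
have [n] := ubnP (size w); elim: n w => // n IHn w ltn sa w0 pos.
case irr: (irreducible w); first by exists [::], w.
move: irr; rewrite (positive_irreducible sa pos) w0 /= => /negbFE/N_reducibleP.
case=> q [r [def_w q0 r0 cop posr]]; subst w.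
have saq := self_avoiding_prefix sa; have sar := self_avoiding_suffix sa.
have [|//|//|//|r1 [p [def_r br irr posp]]] := IHn r.
  by move: ltn q0; rewrite size_cat -size_eq0; case: (size q) => //; lia.
exists (q ++ r1), p; rewrite -catA -def_r; split=> //.
subst r; have sar1 := self_avoiding_prefix sar.
have sa1 : self_avoiding (q ++ r1) by move: sa; rewrite catA; apply: self_avoiding_prefix.
move: br; rewrite !bridgeE // => /andP[pos1 cop1]; rewrite copositive_cat // andbT.
by rewrite positive_cat // (@positive_prefix _ (r1 ++ p)).
Qed.

(** Iterating the factorization of the first factor reaches the first cut. *)
Lemma copositive_factor (w : walk) :
  self_avoiding w -> w != [::] -> copositive w ->
  exists q p, [/\ w = q ++ p, irreducible q, copositive q & positive p].
Proof.
have [n] := ubnP (size w); elim: n w => // n IHn w ltn sa w0 cop.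
case irr: (irreducible w); first by exists w, [::]; rewrite cats0.
move: irr; rewrite (copositive_irreducible sa cop) w0 /= => /negbFE/N_reducibleP.
case=> q [r [def_w q0 r0 copq posr]]; subst w.
have saq := self_avoiding_prefix sa.
have [|//|//|//|q1 [p [def_q irr cop1 posp]]] := IHn q.
  by move: ltn r0; rewrite size_cat -size_eq0; case: (size r) => //; lia.
by exists q1, (p ++ r); rewrite catA -def_q; split=> //; apply: positive_cat.
Qed.

(** * Length generating functions *)

Lemma coefs_walk_gf (C : pred walk) (n : nat) :
  coefs (walk_gf C) n = \sum_(w : n.-tuple step) (self_avoiding w && C w)%:R.
Proof.
rewrite /= -sum1_card natr_sum big_mkcond /=; apply: eq_bigr => w _.
by rewrite inE; case: (_ && _).
Qed.

Lemma eq_walk_gf (C D : pred walk) :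
  (forall w, self_avoiding w -> C w = D w) -> walk_gf C = walk_gf D.
Proof.
move=> eqCD; apply: fpsP => n; rewrite !coefs_walk_gf; apply: eq_bigr => w _.
by case: (boolP (self_avoiding w)) => //= /eqCD->.
Qed.

Lemma walk_gf_add (A B C D : pred walk) :
  (forall w, self_avoiding w -> (A w + B w = C w + D w)%N) ->
  walk_gf A + walk_gf B = walk_gf C + walk_gf D.
Proof.
move=> eqABCD; apply: fpsP => n.
rewrite -[LHS]/(coefs (walk_gf A) n + coefs (walk_gf B) n).
rewrite -[RHS]/(coefs (walk_gf C) n + coefs (walk_gf D) n).
rewrite !coefs_walk_gf -!big_split /=; apply: eq_bigr => w _.
case: (boolP (self_avoiding w)) => [/eqABCD eqw|_] //=.
by rewrite -!natrD eqw.
Qed.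

Lemma walk_gf_pred0 : walk_gf pred0 = 0.
Proof.
apply: fpsP => n; rewrite coefs_walk_gf big1 // => w _.
by rewrite andbF.
Qed.

Lemma walk_gf_disjoint (A B C : pred walk) :
  (forall w, self_avoiding w -> C w = (A w + B w)%N :> nat) ->
  walk_gf C = walk_gf A + walk_gf B.
Proof.
by move=> eqC; rewrite -[LHS]addr0 -walk_gf_pred0; apply: walk_gf_add => w /eqC->; rewrite addn0.
Qed.

Lemma walk_gf_nil : walk_gf (pred1 [::]) = 1.
Proof.
apply: fpsP => n; rewrite coefs_walk_gf; case: n => [|n].
  rewrite (bigD1 [tuple]) //= big1 ?addr0 // => w /eqP[].
  exact: tuple0.
by rewrite big1 // => w _; rewrite /= -size_eq0 size_tuple andbF.
Qed.

Lemma walk_gf_step (s : step) : walk_gf (pred1 [:: s]) = fps_t.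
Proof.
apply: fpsP => n; rewrite coefs_walk_gf; have [->|neq1] := eqVneq n 1%N.
  rewrite (bigD1 [tuple s]) //= eqxx big1 ?addr0 => [|w].
    by case: s.
  by rewrite -val_eqE /= => /negPf->; rewrite andbF.
rewrite /= (negPf neq1) big1 // => w _.
rewrite /= (_ : (tval w == _) = false) ?andbF //; apply/eqP => eqw.
by move: (size_tuple w) neq1; rewrite eqw => <-.
Qed.

Lemma walk_gf_map (f : step -> step) (C : pred walk) :
  involutive f -> (forall w, self_avoiding (map f w) = self_avoiding w) ->
  walk_gf (fun w => C (map f w)) = walk_gf C.
Proof.
move=> fK saf; apply: fpsP => n; rewrite !coefs_walk_gf.
rewrite [RHS](reindex_inj (h := fun w : n.-tuple step => map_tuple f w)) /=.
  by apply: eq_bigr => w _; rewrite saf.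
by move=> u v /(congr1 val) /= /(inj_map (inv_inj fK)) /val_inj.
Qed.

Lemma sum_tuple_cat (m k : nat) (F G : pred walk) :
  \sum_(w : (m + k).-tuple step) (F (take m w) && G (drop m w))%:R
    = (\sum_(u : m.-tuple step) (F u)%:R) * (\sum_(v : k.-tuple step) (G v)%:R) :> rat.
Proof.
rewrite big_distrlr /= pair_big /=.
have cat_bij : bijective (fun x : m.-tuple step * k.-tuple step => cat_tuple x.1 x.2).
  apply: inj_card_bij => [[u v] [u' v'] /(congr1 val) /= /eqP|].
    by rewrite eqseq_cat ?size_tuple // => /andP[/eqP/val_inj-> /eqP/val_inj->].
  by rewrite card_prod !card_tuple expnD.
rewrite (reindex _ (onW_bij _ cat_bij)) /=; apply: eq_bigr => -[u v] _ /=.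
rewrite take_size_cat ?size_tuple // drop_size_cat ?size_tuple //.
by rewrite -natrM mulnb.
Qed.

(** Unique factorization of the walks of [A] into a walk of [C] followed by a
    walk of [D]. Uniqueness is the last hypothesis: no nonempty [r] can be moved
    from the head of the second factor to the tail of the first. *)
Lemma walk_gf_mul (A C D : pred walk) :
  (forall w, self_avoiding w -> A w -> exists q p, [/\ w = q ++ p, C q & D p]) ->
  (forall q p, self_avoiding q -> self_avoiding p -> C q -> D p ->
     self_avoiding (q ++ p) /\ A (q ++ p)) ->
  (forall q r p, self_avoiding (q ++ r) -> self_avoiding (r ++ p) -> r != [::] ->
     C q -> D (r ++ p) -> C (q ++ r) -> D p -> False) ->
  walk_gf A = walk_gf C * walk_gf D.
Proof.
move=> factA catA uniqA; apply: fpsP => n.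
rewrite -[RHS]/(\sum_(i < n.+1) coefs (walk_gf C) i * coefs (walk_gf D) (n - i)%N).
pose C' w := self_avoiding w && C w; pose D' w := self_avoiding w && D w.
transitivity (\sum_(i < n.+1) \sum_(w : n.-tuple step)
                 ((C' (take i w) && D' (drop i w))%:R : rat)); last first.
  apply: eq_bigr => i _; rewrite !coefs_walk_gf.
  rewrite -(sum_tuple_cat i (n - i) C' D').
  have eqn : n = (i + (n - i))%N by rewrite subnKC // -ltnS.
  by rewrite -eqn.
rewrite exchange_big coefs_walk_gf /=; apply: eq_bigr => w _.
have uniqC (i j : nat) : (i < j <= n)%N ->
    C' (take i w) && D' (drop i w) -> C' (take j w) && D' (drop j w) -> False.
  move=> ltij /andP[/andP[_ Ci] /andP[sai Di]] /andP[/andP[saj Cj] /andP[_ Dj]].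
  pose r := take (j - i) (drop i w).
  have eq_take : take j w = take i w ++ r by rewrite -takeD subnKC //; lia.
  have eq_drop : drop i w = r ++ drop j w.
    by rewrite -[LHS](cat_take_drop (j - i)) drop_drop subnK //; lia.
  apply: (uniqA (take i w) r (drop j w)); rewrite -?eq_take -?eq_drop //.
  by rewrite -size_eq0 size_take size_drop size_tuple; case: ifP; lia.
case: (boolP (self_avoiding w && A w)) => [/andP[sa Aw] | nAw]; last first.
  rewrite big1 // => i _; case: (boolP (C' _ && _)) => // /andP[].
  case/andP=> sai Ci /andP[saj Dj]; case/negP: nAw.
  by have [] := catA _ _ sai saj Ci Dj; rewrite cat_take_drop => -> ->.
have [q [p [def_w Cq Dp]]] := factA _ sa Aw.
have leq : (size q < n.+1)%N by rewrite -(size_tuple w) def_w size_cat ltnS leq_addr.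
have CDq : C' (take (size q) w) && D' (drop (size q) w).
  rewrite def_w take_size_cat // drop_size_cat // /C' /D' Cq Dp.
  rewrite def_w in sa.
  by rewrite (self_avoiding_prefix sa) (self_avoiding_suffix sa).
rewrite (bigD1 (Ordinal leq)) //= CDq big1 ?addr0 // => i neqi.
case: (boolP (C' _ && _)) => // CDi; case: (ltngtP i (size q)) => [lti|lti|eqi].
- by case: (uniqC i (size q)) => //; rewrite lti.
- by case: (uniqC (size q) i) => //; rewrite lti -ltnS ltn_ord.
- by case/eqP: neqi; apply: val_inj.
Qed.

(** * Factorizations in a class of walks stable under cuts *)

(** A class of walks containing the empty walk, invariant under the reflection
    through the x-axis, and such that a copositive walk followed by a positive
    one belongs to the class exactly when both of them do. *)
Definition cut_stable (C : pred walk) : Prop :=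
  [/\ C [::],
      forall w, self_avoiding w -> C (reflection w) = C w &
      forall q p, self_avoiding q -> self_avoiding p -> copositive q -> positive p ->
        C (q ++ p) = C q && C p].

Lemma bridge_positive {w : walk} : self_avoiding w -> bridge w -> positive w.
Proof. by move=> sa; rewrite bridgeE // => /andP[]. Qed.

Lemma bridge_copositive {w : walk} : self_avoiding w -> bridge w -> copositive w.
Proof. by move=> sa; rewrite bridgeE // => /andP[]. Qed.

Lemma irreducible_neq0 {w : walk} : irreducible w -> w != [::].
Proof. by case/and3P. Qed.

Lemma irreducible_cut {q p : walk} :
  irreducible (q ++ p) -> q != [::] -> p != [::] -> copositive q -> positive p -> False.
Proof.
case/and3P=> _ /N_reducibleP nred _ q0 p0 cop pos; apply: nred.
by exists q, p.
Qed.

Lemma cat_neq0r (q p : walk) : p != [::] -> q ++ p != [::].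
Proof. by rewrite -!size_eq0 size_cat addn_eq0 negb_and orbC => ->. Qed.

Lemma cat_neq0l (q p : walk) : q != [::] -> q ++ p != [::].
Proof. by rewrite -!size_eq0 size_cat addn_eq0 negb_and => ->. Qed.

Lemma walk_gf_positive (C : pred walk) : cut_stable C ->
  walk_gf [pred w | [&& C w, w != [::] & positive w]]
    = walk_gf [pred w | C w && bridge w]
      * walk_gf [pred w | [&& C w, irreducible w & positive w]].
Proof.
case=> C0 _ Ccat; apply: walk_gf_mul => /=.
- move=> w sa /and3P[Cw w0 pos].
  have [q [p [def_w br irr posp]]] := positive_factor w sa w0 pos.
  exists q, p; rewrite {}def_w in sa Cw *; rewrite br irr posp /= !andbT.
  have saq := self_avoiding_prefix sa; have sap := self_avoiding_suffix sa.
  by move: Cw; rewrite Ccat ?(bridge_copositive saq br) // => /andP[-> ->].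
- move=> q p saq sap /andP[Cq br] /and3P[Cp irr posp].
  have cop := bridge_copositive saq br.
  rewrite Ccat ?cop // Cq Cp self_avoiding_cat //=.
  by rewrite positive_cat ?(bridge_positive saq br) // cat_neq0r // irreducible_neq0.
- move=> q r p saqr sarp r0 _ /and3P[_ irr _] /andP[_ br] /and3P[_ irrp posp].
  apply: (irreducible_cut irr r0 (irreducible_neq0 irrp) _ posp).
  exact: (copositive_suffix q r saqr (bridge_copositive saqr br)).
Qed.

Lemma walk_gf_copositive (C : pred walk) : cut_stable C ->
  walk_gf [pred w | [&& C w, w != [::] & copositive w]]
    = walk_gf [pred w | [&& C w, irreducible w & copositive w]]
      * walk_gf [pred w | C w && bridge w].
Proof.
case=> C0 _ Ccat; apply: walk_gf_mul => /=.
- move=> w sa /and3P[Cw w0 cop].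
  have [q [p [def_w irr copq posp]]] := copositive_factor w sa w0 cop.
  exists q, p; rewrite {}def_w in sa Cw cop *; rewrite irr copq /= !andbT.
  have saq := self_avoiding_prefix sa; have sap := self_avoiding_suffix sa.
  rewrite bridgeE // posp (copositive_suffix q p) // andbT.
  by move: Cw; rewrite Ccat // => /andP[-> ->].
- move=> q p saq sap /and3P[Cq irr cop] /andP[Cp br].
  have pos := bridge_positive sap br.
  have sa := self_avoiding_cat q p saq sap cop pos.
  rewrite Ccat // Cq Cp sa /= cat_neq0l ?irreducible_neq0 //.
  by rewrite copositive_cat // (bridge_copositive sap).
- move=> q r p saqr sarp r0 /and3P[_ irrq copq] /andP[_ br] /and3P[_ irr _] _.
  apply: (irreducible_cut irr (irreducible_neq0 irrq) r0 copq).
  exact: (positive_prefix r p (bridge_positive sarp br)).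
Qed.

Lemma walk_gf_N_reducible (C : pred walk) : cut_stable C ->
  walk_gf [pred w | C w && N_reducible w]
    = walk_gf [pred w | [&& C w, irreducible w & copositive w]]
      * walk_gf [pred w | [&& C w, w != [::] & positive w]].
Proof.
case=> C0 _ Ccat; apply: walk_gf_mul => /=.
- move=> w sa /andP[Cw /N_reducibleP[q1 [p1 [def_w q0 p0 cop pos]]]]; subst w.
  have saq1 := self_avoiding_prefix sa.
  have [q [r [def_q irr copq posr]]] := copositive_factor q1 saq1 q0 cop.
  exists q, (r ++ p1); subst q1; rewrite -catA in sa Cw *; rewrite irr copq cat_neq0r //=.
  have posp := positive_cat r p1 posr pos; rewrite posp !andbT.
  have saq := self_avoiding_prefix sa; have sap := self_avoiding_suffix sa.
  by move: Cw; rewrite Ccat // => /andP[-> ->].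
- move=> q p saq sap /and3P[Cq irr cop] /and3P[Cp p0 pos].
  rewrite Ccat // Cq Cp self_avoiding_cat //=; split=> //.
  by apply/N_reducibleP; exists q, p; rewrite irreducible_neq0.
- move=> q r p saqr sarp r0 /and3P[_ irrq copq] /and3P[_ _ pos] /and3P[_ irr _] _.
  apply: (irreducible_cut irr (irreducible_neq0 irrq) r0 copq).
  exact: (positive_prefix r p pos).
Qed.

(** N-reducible walks go strictly up and S-reducible ones strictly down, so a
    walk is either empty, or irreducible, or reducible in exactly one way. *)
Lemma walk_gf_irreducible (C : pred walk) : cut_stable C ->
  walk_gf C = 1 + walk_gf [pred w | C w && irreducible w]
    + 2%:R * (walk_gf [pred w | [&& C w, irreducible w & copositive w]]
              * walk_gf [pred w | C w && bridge w]
              * walk_gf [pred w | [&& C w, irreducible w & positive w]]).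
Proof.
move=> Cst; have [C0 Crefl _] := Cst.
rewrite -mulrA -walk_gf_positive // -walk_gf_N_reducible //.
have gfS : walk_gf [pred w | C w && S_reducible w] = walk_gf [pred w | C w && N_reducible w].
  rewrite -(walk_gf_map reflect_step [pred w | C w && N_reducible w]) //.
  - by apply: eq_walk_gf => w sa /=; rewrite -/(reflection w) Crefl.
  - exact: reflect_stepK.
  - exact: self_avoiding_reflection.
rewrite mulr_natl mulr2n -[X in _ + (X + _)]gfS -walk_gf_nil.
pose red := [pred w | C w && (N_reducible w || S_reducible w)].
pose irr1 := [pred w | (w == [::]) || (C w && irreducible w)].
rewrite -(walk_gf_disjoint _ _ irr1); last first.
  by move=> w _ /=; case: eqP => [->|_] //=; rewrite /irreducible /= andbF.
rewrite -(walk_gf_disjoint _ _ red); last first.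
  move=> w sa /=; case: (C w) => //=.
  have := @N_reducible_rise w sa; have := @S_reducible_rise w sa.
  by case: (N_reducible w); case: (S_reducible w) => // /(_ isT) + /(_ isT); lia.
apply: walk_gf_disjoint => w sa /=; have [->|w0] := eqVneq w [::]; last first.
  rewrite /irreducible w0 /=; case: (C w) => //=.
  by case: (N_reducible w); case: (S_reducible w).
have := @N_reducible_rise [::] isT; have := @S_reducible_rise [::] isT.
rewrite C0 rise_nil /=.
by case: (N_reducible _) => [_ /(_ isT) //|]; case: (S_reducible _) => [/(_ isT)|].
Qed.

(** * NES-walks *)

Lemma NESE (w : walk) : NES w = (West \notin w).
Proof.
rewrite -has_pred1 -all_predC; apply: eq_all => s /=.
by rewrite !inE; case: s; do 4?case: eqP => //=.
Qed.

Lemma NES_cut_stable : cut_stable NES.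
Proof.
split=> // [w _ | q p _ _ _ _]; last exact: all_cat.
by rewrite !NESE (mem_map (inv_inj reflect_stepK) w West).
Qed.

(** A nonempty NES-bridge is an NES-pseudo-bridge followed by a step N. *)
Lemma walk_gf_NES_bridge :
  walk_gf [pred w | NES w && bridge w]
    = 1 + fps_t * walk_gf [pred w | NES w && pseudo_bridge w].
Proof.
rewrite mulrC -(walk_gf_step North) -walk_gf_nil.
pose br1 := [pred w | [&& NES w, w != [::] & bridge w]].
transitivity (walk_gf (pred1 [::]) + walk_gf br1).
  by apply: walk_gf_disjoint => w _ /=; have [->|] := eqVneq w [::].
congr (_ + _); apply: walk_gf_mul => /=.
- move=> w sa /and3P[nes w0 br]; case/lastP: w => [//|q s] in sa nes w0 br *.
  exists q, [:: s]; rewrite cats1; split=> //.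
    move: nes; rewrite /NES all_rcons => /andP[_ ->] /=.
    apply/pseudo_bridgeP => i.
    have /positiveP pos := bridge_positive sa br.
    have /(copositiveP _ sa) cop := bridge_copositive sa br.
    wlog lei : i / (i <= size q)%N.
      move=> ind; case: (leqP i (size q)) => [/ind //|/ltnW lti].
      by have := ind (size q) (leqnn _); rewrite take_size take_oversize.
    have := cop i; have := cop (size q); have := pos i.
    rewrite size_rcons -cats1 !takel_cat // take_size rise_cat !ltnS leqnn lei.
    have : rise [:: s] <= 1 by case: (s).
    by move=> ? ? /(_ isT) + /(_ isT); lia.
  have /(copositiveP _ sa)/(_ (size q)) := bridge_copositive sa br.
  rewrite size_rcons -cats1 take_size_cat // rise_cat ltnS leqnn => /(_ isT).
  by rewrite /rise displacement1; case: (s) => //=; lia.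
- move=> q p saq sap /andP[nes /pseudo_bridgeP pb] /eqP->.
  have sa : self_avoiding (q ++ [:: North]).
    apply/self_avoidingP => i j /andP[ltij]; rewrite size_cat addn1 => lej.
    rewrite takel_cat; last by lia.
    move: lej; rewrite leq_eqVlt => /orP[/eqP->|ltj] eqij; last first.
      by apply: (self_avoidingP _ saq i j); rewrite ?ltij // eqij takel_cat.
    have /= := congr1 snd eqij; rewrite -!/(rise _) [take _ (q ++ _)]take_oversize ?size_cat ?addn1 //.
    by rewrite rise_cat /=; have := pb i; rewrite /(rise [:: _]) /=; lia.
  split=> //; rewrite /NES all_cat -/(NES q) nes cat_neq0r //= bridgeE //.
  rewrite !inE eqxx /=; apply/andP; split.
    apply/positiveP => i; rewrite rise_take_cat; case: ifP => _; first by have := pb i; lia.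
    have := pb (size q); rewrite take_size.
    by case: (i - size q)%N => [|j]; rewrite /= ?take0 /rise /displacement /=; lia.
  apply/copositiveP => // i; rewrite size_cat addn1 ltnS => lei.
  by rewrite takel_cat // rise_cat; have := pb i; rewrite /(rise [:: _]) /=; lia.
- move=> q r p _ _ r0 _ /eqP eqr _ /eqP eqp; move: eqr; rewrite eqp.
  by case: r r0 => // s [].
Qed.

Lemma unit_one_add_t_mul (F : {fps rat}) : 1 + fps_t * F \is a GRing.unit.
Proof.
rewrite -[_ \is a _]/(coefs (1 + fps_t * F) 0 \is a GRing.unit).
rewrite -[coefs _ 0]/(1%:R + \sum_(i < 1) coefs fps_t i * coefs F (0 - i)%N).
by rewrite big_ord1 mul0r addr0.
Qed.

(** * Irreducible weakly directed walks *)

(** The step in the opposite direction. *)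
Definition opposite (s : step) : step :=
  match s with North => South | South => North | East => West | West => East end.

(** A self-avoiding walk whose steps are all parallel never turns back. *)
Lemma straight_walk (s : step) (w : walk) :
  self_avoiding w -> {subset w <= [:: s; opposite s]} ->
  exists2 s', s' \in [:: s; opposite s] & w = nseq (size w) s'.
Proof.
elim: w => [|x w IHw] sa sub; first by exists s; rewrite ?mem_head.
have [||y memy def_w] := IHw; first exact: (@self_avoiding_suffix [:: x]).
  by move=> z memz; apply: sub; rewrite inE memz orbT.
have memx : x \in [:: s; opposite s] by apply: sub; rewrite mem_head.
case: w => [|z w] /= in sa def_w {IHw sub} *; first by exists x.
exists y; rewrite //= -def_w; congr (_ :: _); case: def_w => def_z _; subst z.
move/self_avoidingP: sa => /(_ 0 2 isT); rewrite take0 /= take0.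
by move: memx memy; rewrite !inE => /orP[]/eqP-> /orP[]/eqP->; case: s => // -[].
Qed.

Lemma rise_count (w : walk) : rise w = (count_mem North w)%:Z - (count_mem South w)%:Z.
Proof.
elim: w => // s w IHw; rewrite rise_cons {}IHw /= /rise displacement1.
by case: s => /=; do 2?case: eqP => //=; lia.
Qed.

Lemma weakly_directedP (w : walk) :
  reflect (forall i j, (i < j <= size w)%N -> rise (take i w) = rise (take j w) ->
             exists s, s \notin take (j - i) (drop i w))
          (weakly_directed w).
Proof.
apply: (iffP forallP) => [wd i j /andP[ltij lej] eqij | wd i].
  have lei := leq_trans (ltnW ltij) lej.
  have /forallP/(_ (Ordinal (lej : j < (size w).+1)%N)) := wd (Ordinal (lei : i < (size w).+1)%N).
  by rewrite /= ltij !vertexE // /height -!/(rise _) eqij eqxx => /existsP.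
apply/forallP => j; have lei : (i <= size w)%N := ltn_ord i.
have lej : (j <= size w)%N := ltn_ord j.
apply/implyP; rewrite !vertexE // => /andP[ltij /eqP eqij].
by apply/existsP; apply: wd => //; rewrite ltij.
Qed.

(** Between two vertices of equal height, a weakly directed walk does not use
    both horizontal directions: if it avoids N or S there, then it avoids
    both, and a horizontal self-avoiding walk is straight. *)
Lemma weakly_directed_level {w : walk} {i j : nat} :
  self_avoiding w -> weakly_directed w -> (i < j <= size w)%N ->
  East \in take (j - i) (drop i w) -> West \in take (j - i) (drop i w) ->
  rise (take i w) <> rise (take j w).
Proof.
move=> sa /weakly_directedP wd ltij memE memW eqij.
have [s nots] := wd i j ltij eqij; set f := take _ _ in memE memW nots.
have def_w : w = take i w ++ f ++ drop j w.
  rewrite -[LHS](cat_take_drop i); congr (_ ++ _).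
  by rewrite -[LHS](cat_take_drop (j - i)) drop_drop subnK //; lia.
have saf : self_avoiding f.
  by move: sa; rewrite def_w => /self_avoiding_suffix/self_avoiding_prefix.
have rf : rise f = 0.
  have : take j w = take i w ++ f by rewrite -takeD subnKC //; lia.
  by move/(congr1 rise); rewrite rise_cat -eqij; lia.
have [notN notS] : North \notin f /\ South \notin f.
  move: rf; rewrite rise_count -!has_pred1 !has_count.
  have : ~~ has (pred1 s) f by rewrite has_pred1.
  rewrite has_count; case: s nots => nots; last by rewrite memW in nots.
  - by lia.
  - by rewrite memE in nots.
  - by lia.
have sub : {subset f <= [:: East; opposite East]}.
  move=> x memx; rewrite !inE; case: x memx => //=; rewrite ?eqxx ?orbT //.
    by rewrite (negPf notN).
  by rewrite (negPf notS).
have [s' _ def_f] := straight_walk East f saf sub.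
move: memE memW; rewrite def_f !mem_nseq => /andP[_ /eqP<-] /andP[_ /eqP].
by [].
Qed.

Lemma mem_factor (w : walk) (i k j : nat) (s : step) :
  (i <= k < j)%N -> (k < size w)%N -> nth s w k = s -> s \in take (j - i) (drop i w).
Proof.
move=> /andP[leik ltkj] ltk def_s; rewrite -[X in X \in _]def_s.
have -> : nth s w k = nth s (take (j - i) (drop i w)) (k - i).
  by rewrite nth_take ?nth_drop ?subnKC //; lia.
have ltki : (k - i < size (take (j - i) (drop i w)))%N.
  by rewrite size_take size_drop; case: ifP; lia.
exact: mem_nth ltki.
Qed.

(** Let a horizontal step, a run of N steps and the opposite horizontal step occur
    consecutively. By [weakly_directed_level] no vertex up to the start of the
    first horizontal step is at the same height as a vertex from the end of the
    second one on. As heights vary by at most one at each step, the former all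
    lie below the latter. The walk can then be cut at the first vertex of the
    run that is above all the vertices up to the start of the first horizontal
    step. *)
Lemma turn_N_reducible (a c : walk) (s s' : step) (m : nat) :
  s' = opposite s -> s \in [:: East; West] -> (0 < m)%N ->
  let w := a ++ s :: nseq m North ++ s' :: c in
  self_avoiding w -> weakly_directed w -> N_reducible w.
Proof.
move=> def_s' mems m0 w sa wd.
pose e := size a; pose i := (e + 1 + m)%N.
pose H k := rise (take k w).
have size_w : size w = (i + 1 + size c)%N.
  by rewrite /w size_cat /= size_cat size_nseq /= /i /e; lia.
have rs : rise [:: s] = 0 by move: mems; rewrite !inE => /orP[]/eqP->.
have rs' : rise [:: s'] = 0 by rewrite def_s'; move: mems; rewrite !inE => /orP[]/eqP->.
have He : H e = rise a by rewrite /H take_size_cat.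
have Hrun l : (l <= m)%N -> H (e + 1 + l)%N = H e + l%:Z.
  move=> lel; rewrite He /H /w -addnA takeD take_size_cat // drop_size_cat // add1n /=.
  rewrite takel_cat ?size_nseq // take_nseq // rise_cat rise_cons rs rise_nseq.
  by rewrite add0r.
have HSi : H i.+1 = H i.
  rewrite /i Hrun // He /H /w -addnS -addnA takeD take_size_cat // drop_size_cat // add1n /=.
  rewrite take_cat size_nseq ltnNge leqnSn /= subSn // subnn /= take0.
  by rewrite rise_cat rise_cons rise_cat rs rs' rise_nseq; lia.
have Hstep k : `|H k.+1 - H k| <= 1 by exact: rise_take_step.
have nth_e : nth s w e = s by rewrite /w nth_cat ltnn subnn.
have nth_i : nth s' w i = s'.
  rewrite /w nth_cat /i /e ltnNge -addnA leq_addr /= addKn add1n /=.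
  by rewrite nth_cat size_nseq ltnn subnn.
(* [x] is before the first horizontal step and [y] after the second one *)
have neqH x y : (x <= e)%N -> (i < y <= size w)%N -> H x <> H y.
  move=> lex /andP[lty ley].
  have mem_s : s \in take (y - x) (drop x w).
    by apply: (mem_factor w x e y s) => //; rewrite /i in lty *; lia.
  have mem_s' : s' \in take (y - x) (drop x w).
    by apply: (mem_factor w x i y s') => //; rewrite /i in lty *; lia.
  apply: weakly_directed_level => //; first by rewrite /i in lty *; lia.
    by move: mems mem_s mem_s'; rewrite def_s' !inE => /orP[]/eqP->.
  by move: mems mem_s mem_s'; rewrite def_s' !inE => /orP[]/eqP->.
(* the inequality [H e < H i.+1] is propagated to the right, then to the left *)
have lt_eH d : (i + d.+1 <= size w)%N -> H e < H (i + d.+1)%N.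
  elim: d => [|d IHd] led; first by rewrite addn1 HSi /i Hrun //; lia.
  have := IHd ltac:(lia); have := Hstep (i + d.+1)%N; rewrite -addnS.
  by have := neqH e (i + d.+2)%N (leqnn _) ltac:(lia); lia.
have ltH0 d y : (d <= e)%N -> (i < y <= size w)%N -> H (e - d)%N < H y.
  move=> led ley; elim: d led => [|d IHd] led.
    by have := lt_eH (y - i.+1)%N; rewrite subn0 -addSnnS subnKC //; lia.
  have := IHd ltac:(lia); have := Hstep (e - d.+1)%N.
  have -> : (e - d.+1).+1 = (e - d)%N by lia.
  by have := neqH (e - d.+1)%N y ltac:(lia) ley; lia.
have ltH x y : (x <= e)%N -> (i < y)%N -> H x < H y.
  move=> lex lty; case: (leqP y (size w)) => [ley | /ltnW ley].
    by have := ltH0 (e - x)%N y; rewrite subKn // lty ley; apply; lia.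
  have -> : H y = H (size w) by rewrite /H take_size take_oversize.
  by have := ltH0 (e - x)%N (size w); rewrite subKn //; apply; lia.
pose above k := (e < k)%N && all (fun x => H x < H k) (iota 0 e.+1).
have aboveP k x : above k -> (x <= e)%N -> H x < H k.
  by move=> /andP[_ /allP ab] lex; apply: ab; rewrite mem_iota add0n ltnS.
have above_i : above i.
  apply/andP; split; first by rewrite /i; lia.
  by apply/allP => x; rewrite mem_iota ltnS -HSi => /andP[_ lex]; apply: ltH.
case: (ex_minnP (ex_intro above i above_i)) => k ab_k min_k.
have ltek : (e < k)%N by case/andP: ab_k.
have leki : (k <= i)%N by apply: min_k.
have ltSek : (e.+1 < k)%N.
  rewrite ltn_neqAle ltek andbT; apply/eqP => def_k.
  by have := aboveP k e ab_k (leqnn e); rewrite -def_k -[e.+1]addn1 -[(e + 1)%N]addn0 Hrun //; lia.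
have HkE j : (e < j <= i)%N -> H j = H e + (j - e.+1)%:Z.
  by move=> lej; rewrite -Hrun; [congr H | ]; rewrite /i in lej *; lia.
have Hk : H k = H e + (k - e.+1)%:Z by apply: HkE; rewrite ltek.
have leHk y : (k <= y)%N -> H k <= H y.
  move=> leky; case: (leqP y i) => [ley | lty].
    rewrite Hk (HkE y); first by clear -leky ltek; lia.
    by rewrite ley (leq_trans ltek leky).
  (* by minimality of [k], some vertex [x <= e] is at least as high as vertex [k.-1] *)
  have : ~~ above k.-1.
    by apply/negP => /min_k; rewrite leqNgt ltn_predL (leq_ltn_trans _ ltek).
  rewrite negb_and -leqNgt; case/orP; first by clear -ltSek; lia.
  case/allPn => x; rewrite mem_iota ltnS => /andP[_ lex].
  rewrite Hk (HkE k.-1); last by clear -ltSek leki; lia.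
  by have := ltH x y lex lty; clear -ltSek; lia.
apply/N_reducibleP; exists (take k w), (drop k w); split.
- by rewrite cat_take_drop.
- by rewrite -size_eq0 size_take size_w; case: ifP; lia.
- by rewrite -size_eq0 size_drop size_w; lia.
- apply/copositiveP => [|j].
    by apply: (@self_avoiding_prefix _ (drop k w)); rewrite cat_take_drop.
  rewrite size_take => ltj.
  have {}ltj : (j < k)%N by move: ltj; case: ifP; lia.
  rewrite take_takel ?(ltnW ltj) // -!/(H _).
  case: (leqP j e) => [/(aboveP k j ab_k) // | ltej].
  rewrite Hk (HkE j); first by clear -ltj ltej; lia.
  by rewrite ltej (leq_trans (ltnW ltj) leki).
- apply/positiveP => j; have := leHk (k + j)%N (leq_addr _ _).
  by rewrite /H takeD rise_cat; lia.
Qed.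

Lemma weakly_directed_reflection (w : walk) :
  weakly_directed (reflection w) = weakly_directed w.
Proof.
suff sub u : weakly_directed u -> weakly_directed (reflection u).
  by apply/idP/idP => [/sub|/sub //]; rewrite reflectionK.
move=> /weakly_directedP wd; apply/weakly_directedP => i j; rewrite size_map => ltij.
rewrite /reflection -!map_take -!/(reflection _) !rise_reflection => /oppr_inj eqij.
have [s nots] := wd i j ltij eqij; exists (reflect_step s).
by rewrite -map_drop -map_take mem_map //; exact: (inv_inj reflect_stepK).
Qed.

Lemma weakly_directed_cut_stable : cut_stable weakly_directed.
Proof.
split; [|by move=> w _; exact: weakly_directed_reflection|].
  by apply/weakly_directedP => i j /=; lia.
move=> q p saq sap cop pos.
apply/weakly_directedP/andP => [wd | [/weakly_directedP wdq /weakly_directedP wdp] i j].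
  split; apply/weakly_directedP => i j ltij eqij.
    have [|| s nots] := wd i j; first by rewrite size_cat; lia.
      by rewrite !takel_cat //; lia.
    exists s; apply: contra nots; rewrite drop_cat; case: ifP => lti; last by lia.
    by rewrite takel_cat // size_drop; lia.
  have [|| s nots] := wd (size q + i)%N (size q + j)%N; first by rewrite size_cat; lia.
    by rewrite !takeD take_size_cat // drop_size_cat // !rise_cat eqij.
  exists s; move: nots; rewrite subnDl drop_cat ltnNge leq_addr /=.
  by rewrite addKn.
rewrite size_cat => ltij.
move/(copositiveP _ saq): cop => cop; move/positiveP: pos => pos.
rewrite !take_cat drop_cat; case: (ltnP i (size q)) => [lti|lei].
  case: (ltnP j (size q)) => [ltj|lej] eqij.
    rewrite takel_cat ?size_drop; last by lia.
    by apply: wdq => //; lia.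
  by have := cop i lti; have := pos (j - size q)%N; rewrite eqij rise_cat; lia.
rewrite ltnNge (leq_trans lei) /=; last by lia.
rewrite !rise_cat => /addrI eqij.
have -> : (j - i = (j - size q) - (i - size q))%N by lia.
by apply: wdp => //; lia.
Qed.

Lemma first_occurrence {s : step} {w : walk} :
  s \in w -> exists u v, w = u ++ s :: v /\ s \notin u.
Proof.
elim: w => // x w IHw; have [->|neq] := eqVneq s x; first by exists [::], w.
rewrite inE (negPf neq) => /IHw[u [v [-> notu]]].
by exists (x :: u), v; rewrite inE (negPf neq).
Qed.

(** Two opposite horizontal steps with only vertical steps in between. *)
Lemma exists_turn {w : walk} : East \in w -> West \in w ->
  exists a s u c, [/\ w = a ++ s :: u ++ opposite s :: c, s \in [:: East; West],
                      East \notin u & West \notin u].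
Proof.
elim: w => // x w IHw memE memW.
have [/andP[wE wW]|notEW] := boolP ((East \in w) && (West \in w)).
  have [a [s [u [c [-> mems uE uW]]]]] := IHw wE wW.
  by exists (x :: a), s, u, c.
move: memE memW; rewrite !inE => /orP[/eqP<-|wE] /orP[/eqP eqx|wW] //.
- have [u [c [def_w uW]]] := first_occurrence wW.
  exists [::], East, u, c; rewrite def_w; split; rewrite ?inE ?eqxx ?orbT //.
  by move: notEW; rewrite wW andbT def_w mem_cat negb_or => /andP[].
- have [u [c [def_w uE]]] := first_occurrence wE.
  exists [::], West, u, c; rewrite def_w -eqx; split; rewrite ?inE ?eqxx ?orbT //.
  by move: notEW; rewrite wE def_w mem_cat negb_or => /andP[].
- by rewrite wE wW in notEW.
Qed.

(** Irreducible weakly directed walks are partially directed. *)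
Lemma irreducible_weakly_directed (w : walk) :
  self_avoiding w -> irreducible w ->
  weakly_directed w = (East \notin w) || (West \notin w).
Proof.
move=> sa /and3P[_ nN nS]; apply/idP/idP => [wd | notEW]; last first.
  apply/weakly_directedP => i j _ _.
  by case/orP: notEW => [notE|notW]; [exists East | exists West];
    rewrite ?(contraNN _ notE) ?(contraNN _ notW) // => /mem_take/mem_drop.
rewrite -negb_and; apply/negP => /andP[memE memW].
have [a [s [u [c [def_w mems uE uW]]]]] := exists_turn memE memW; subst w.
have sau : self_avoiding (s :: u ++ opposite s :: c) := self_avoiding_suffix sa.
have {}sau : self_avoiding (u ++ opposite s :: c) by exact: (@self_avoiding_suffix [:: s]).
have sub : {subset u <= [:: North; opposite North]}.
  move=> x; rewrite !inE; case: x => //=; rewrite ?eqxx ?orbT //.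
    by rewrite (negPf uE).
  by rewrite (negPf uW).
have [s' mems' def_u] := straight_walk North u (self_avoiding_prefix sau) sub.
move: (size u) def_u => m def_u; subst u.
case: (posnP m) => [m0|m0].
  have := self_avoiding_suffix sa; rewrite m0 /= => /self_avoidingP/(_ 0 2 isT).
  by rewrite take0 /= take0; move: mems; rewrite !inE => /orP[]/eqP->; apply.
move: mems'; rewrite !inE => /orP[]/eqP def_s'; subst s'.
  by case/negP: nN; apply: turn_N_reducible.
case/negP: nS; rewrite /S_reducible.
move: sa wd; rewrite -self_avoiding_reflection -weakly_directed_reflection.
rewrite /reflection map_cat /= map_cat /= map_nseq /=.
have -> : reflect_step (opposite s) = opposite s by move: mems; rewrite !inE => /orP[]/eqP->.
have -> : reflect_step s = s by move: mems; rewrite !inE => /orP[]/eqP->.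
by apply: turn_N_reducible.
Qed.

Lemma irreducible_vertical (w : walk) :
  self_avoiding w -> irreducible w -> East \notin w -> West \notin w ->
  w = [:: North] \/ w = [:: South].
Proof.
move=> sa irr wE wW.
have sub : {subset w <= [:: North; opposite North]}.
  move=> x; rewrite !inE; case: x => //=; rewrite ?eqxx ?orbT //.
    by rewrite (negPf wE).
  by rewrite (negPf wW).
have red m : N_reducible (nseq m.+2 North).
  apply/N_reducibleP; exists [:: North], (nseq m.+1 North); split=> //.
  apply/positiveP => i; case: (leqP i m.+1) => [lei | /ltnW lti].
    by rewrite take_nseq // rise_nseq.
  by rewrite take_oversize ?size_nseq // rise_nseq.
have [s mems def_w] := straight_walk North w sa sub.
case/and3P: irr => w0; rewrite /S_reducible.
case: (size w) def_w w0 => [|[|m]] -> //.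
  by move: mems; rewrite !inE => /orP[]/eqP->; [left | right].
move: mems; rewrite !inE => /orP[]/eqP-> _; first by rewrite red.
by rewrite /reflection map_nseq /= => _; rewrite red.
Qed.

(** * Generating function of weakly directed walks *)

Lemma irreducible1 (s : step) : irreducible [:: s].
Proof.
have nred x : ~~ N_reducible [:: x].
  apply/negP => /N_reducibleP[q [p [/(congr1 size) /= + q0 p0 _ _]]].
  by move: q0 p0; rewrite -!size_eq0 size_cat; case: (size q) => // n; case: (size p) => // m _ _; lia.
by rewrite /irreducible /S_reducible /= !nred.
Qed.

(** Irreducible weakly directed walks avoid W or avoid E; the mirror image
    exchanges the two cases, which share the vertical walks N and S. *)
Lemma walk_gf_irreducible_weakly_directed (X : pred walk) :
  (forall w, self_avoiding w -> X (map mirror_step w) = X w) ->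
  walk_gf [pred w | [&& weakly_directed w, irreducible w & X w]]
    + (walk_gf [pred w | (w == [:: North]) && X w]
       + walk_gf [pred w | (w == [:: South]) && X w])
  = 2%:R * walk_gf [pred w | [&& NES w, irreducible w & X w]].
Proof.
move=> Xmirror; rewrite mulr_natl mulr2n.
rewrite -[X in _ = _ + X](walk_gf_map mirror_step) //.
- rewrite -(walk_gf_disjoint _ _ [pred w | ((w == [:: North]) || (w == [:: South])) && X w]).
    apply: walk_gf_add => w sa /=; rewrite irreducible_mirror // Xmirror //.
    rewrite !NESE (mem_map (inv_inj mirror_stepK) w East).
    case: (X w); rewrite ?andbF // !andbT.
    case irr: (irreducible w); rewrite ?andbF ?andbT; last first.
      have notw s : (w == [:: s]) = false.
        by apply: contraFF irr => /eqP->; apply: irreducible1.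
      by rewrite !notw.
    rewrite irreducible_weakly_directed //.
    have -> : (w == [:: North]) || (w == [:: South]) = (East \notin w) && (West \notin w).
      apply/orP/andP => [[]/eqP-> | [wE wW]]; try by rewrite !inE; split; apply/eqP.
      by case: (irreducible_vertical w sa irr wE wW) => ->; [left | right].
    by case: (East \notin w); case: (West \notin w).
  move=> w _ /=; case: (X w); rewrite ?andbF // !andbT.
  by have [->|_] := eqVneq w [:: North]; first case: eqP.
- exact: mirror_stepK.
- exact: self_avoiding_mirror.
Qed.

Theorem proposition17 :
  let t : {fps rat} := fps_t in
  let B := walk_gf [pred w | NES w && pseudo_bridge w] in
  let W := walk_gf [pred w | weakly_directed w && bridge w] in
  let T := walk_gf [pred w | NES w] in
  let P := walk_gf [pred w | NES w && positive w] in
  let Q := walk_gf [pred w | NES w && copositive w] in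
  let Ti := walk_gf [pred w | NES w && irreducible w] in
  let Pi := walk_gf [pred w | [&& NES w, irreducible w & positive w]] in
  let Qi := walk_gf [pred w | [&& NES w, irreducible w & copositive w]] in
  let Wbar := walk_gf [pred w | weakly_directed w] in
  [/\ Wbar = 1 + (2%:R * Ti - 2%:R * t)
             + 2%:R * (2%:R * Qi - t) * W * (2%:R * Pi - t),
      Ti = T - 1 - 2%:R * Qi * (1 + t * B) * Pi,
      Pi = (P - 1) / (1 + t * B) &
      Qi = (Q - 1) / (1 + t * B)].
Proof.
move=> t B W T P Q Ti Pi Qi Wbar.
have uB : 1 + t * B \is a GRing.unit := unit_one_add_t_mul B.
have defB : walk_gf [pred w | NES w && bridge w] = 1 + t * B := walk_gf_NES_bridge.
split.
- rewrite [LHS](walk_gf_irreducible weakly_directed weakly_directed_cut_stable) -/W.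
  have gfI : walk_gf [pred w | weakly_directed w && irreducible w] = 2%:R * Ti - 2%:R * t.
    have := walk_gf_irreducible_weakly_directed xpredT (fun _ _ => erefl).
    have -> : walk_gf [pred w | [&& NES w, irreducible w & true]] = Ti.
      by apply: eq_walk_gf => w _ /=; rewrite andbT.
    move <-; rewrite mulr_natl mulr2n.
    have gf1 s : walk_gf [pred w | (w == [:: s]) && true] = t.
      by rewrite -[RHS](walk_gf_step s); apply: eq_walk_gf => w _ /=; rewrite andbT.
    by rewrite !gf1 addrK; apply: eq_walk_gf => w _ /=; rewrite andbT.
  have gfX (X : pred walk) : (forall w, self_avoiding w -> X (map mirror_step w) = X w) ->
      X [:: North] -> ~~ X [:: South] ->
      walk_gf [pred w | [&& weakly_directed w, irreducible w & X w]]
        = 2%:R * walk_gf [pred w | [&& NES w, irreducible w & X w]] - t.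
    move=> Xmirror XN XS; rewrite -(walk_gf_irreducible_weakly_directed X Xmirror).
    have -> : walk_gf [pred w | (w == [:: North]) && X w] = t.
      rewrite -[RHS](walk_gf_step North); apply: eq_walk_gf => w _ /=.
      by case: eqP => [->|].
    have -> : walk_gf [pred w | (w == [:: South]) && X w] = 0.
      rewrite -[RHS]walk_gf_pred0; apply: eq_walk_gf => w _ /=.
      by case: eqP => [->|] //; apply: negPf.
    by rewrite addr0 addrK.
  rewrite gfI (gfX _ copositive_mirror) // (gfX positive) //; first by rewrite -!mulrA.
  by move=> w _; apply: positive_mirror.
- rewrite [T](walk_gf_irreducible NES NES_cut_stable) defB -/Ti -/Pi -/Qi.
  by ring.
- apply: (mulIr uB); rewrite divrK //.
  rewrite -[1 in RHS]walk_gf_nil.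
  have -> : P = walk_gf (pred1 [::])
                + walk_gf [pred w | [&& NES w, w != [::] & positive w]].
    by apply: walk_gf_disjoint => w _ /=; case: eqP => [->|].
  by rewrite [RHS]addrAC subrr add0r (walk_gf_positive NES NES_cut_stable) defB mulrC.
- apply: (mulIr uB); rewrite divrK //.
  rewrite -[1 in RHS]walk_gf_nil.
  have -> : Q = walk_gf (pred1 [::])
                + walk_gf [pred w | [&& NES w, w != [::] & copositive w]].
    by apply: walk_gf_disjoint => w _ /=; case: eqP => [->|].
  by rewrite [RHS]addrAC subrr add0r (walk_gf_copositive NES NES_cut_stable) defB.
Qed.
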